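(* For all integers $n>k\ge 3$, $f_k(n) \le 2n^2$.
   Context: For $k\ge 3$, the $k$-uniform tight path $P_n$ has vertices $v_1<\cdots<v_n$ and edges $\{v_j,\dots,v_{j+k-1}\}$ for $j=1,\dots,n-k+1$; in a red/blue coloring of the $k$-subsets of $[N]$, a blue copy of $P_n$ is a sequence $x_1<\cdots<x_n$ in $[N]$ with every $k$-set $\{x_j,\dots,x_{j+k-1}\}$ blue. $f_k(n)$ is the minimum $N$ such that every red/blue coloring of the $k$-subsets of $[N]$ results in a blue copy of $P_n$ or a set $S\subseteq[N]$ of $k+1$ vertices containing at least $3$ red $k$-subsets, one of which is the set of the $k$ smallest elements of $S$. *)

(* Defs.v *)
(* Written with the Mathematical Components library.  The vertex set [N] is
   'I_N = {0, ..., N-1}, with its usual order. *)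
From mathcomp Require Import all_boot.

Set Implicit Arguments.
Unset Strict Implicit.
Unset Printing Implicit Defensive.

(* With vertices numbered from 0, the edges are the intervals {j, ..., j+k-1}
   for 0 <= j <= n-k.  The truncated subtraction is harmless when k <= n. *)
Definition tight_path (k n : nat) : {set {set 'I_n}} :=
  [set [set i : 'I_n | j <= i < j + k] | j : 'I_(n - k).+1].

(* A red/blue coloring of the k-subsets of [N] is given by a predicate
   [red : pred {set 'I_N}], a k-subset being blue when it is not red; the
   values of [red] on sets of size other than k are never used. *)
Definition blue_tight_path (k n N : nat) (red : pred {set 'I_N}) : Prop :=
  exists x : 'I_n -> 'I_N,
    (forall i j : 'I_n, i < j -> x i < x j) /\
    (forall e : {set 'I_n}, e \in tight_path k n -> ~~ red (x @: e)).

Definition red_ksubsets (k N : nat) (red : pred {set 'I_N}) (S : {set 'I_N}) :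
    {set {set 'I_N}} :=
  [set e : {set 'I_N} | [&& e \subset S, #|e| == k & red e]].

(* For [e \subset S], e consists of the #|e| smallest elements of S. *)
Definition initial_in (N : nat) (S e : {set 'I_N}) : Prop :=
  forall x y : 'I_N, x \in e -> y \in S :\: e -> x < y.

Definition red_configuration (k N : nat) (red : pred {set 'I_N}) : Prop :=
  exists S : {set 'I_N},
    [/\ #|S| = k.+1,
        3 <= #|red_ksubsets k red S| &
        exists2 e : {set 'I_N}, e \in red_ksubsets k red S & initial_in S e].

Definition ramsey_property (k n N : nat) : Prop :=
  forall red : pred {set 'I_N},
    blue_tight_path k n red \/ red_configuration k red.

(* [is_f k n N] is the assertion f_k(n) = N. *)
Definition is_f (k n N : nat) : Prop :=
  ramsey_property k n N /\ forall M : nat, ramsey_property k n M -> N <= M.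

(* Main.v *)
(* A set of k-1 vertices is called i-alive if some blue tight path starts with
   it and has i further vertices.  Cut the vertices into consecutive blocks of
   2n-1 vertices.  By induction on i, counting blocks from the end, for every
   (k-2)-set s to the left of the i-th block fewer than n vertices z of that
   block make s + z not i-alive.

   The point is that, to the left of block i, a k-set e with two (k-1)-subsets
   t1, t2 that are not (i+1)-alive is blue: as less than half of block i is bad
   for t1 without its least element, and likewise for t2, some w there is good
   for both, so t1 + w and t2 + w are red, and a red e would make e + w a red
   configuration.  Now if s + z were not (i+1)-alive for n vertices z of block
   i+1, all sets s + z + z' would be blue, hence s' + z + z' is not
   (i+1)-alive, where s' is s without its least element.  Removing the elements
   of s one by one in this way, all k-subsets of these n vertices are blue, so
   they form a blue path. *)
Require Import Defs.
From Stdlib Require Import Classical.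
From mathcomp Require Import all_boot zify.

Set Implicit Arguments.
Unset Strict Implicit.
Unset Printing Implicit Defensive.

(** * Increasing sequences of naturals *)

Lemma ltn_sorted_rcons (s : seq nat) w :
  sorted ltn (rcons s w) = sorted ltn s && all (ltn^~ w) s.
Proof.
rewrite -(rev_sorted) rev_rcons /= path_sortedE; last first.
  by move=> y x z /= h1 h2; apply: ltn_trans h2 h1.
by rewrite rev_sorted all_rev andbC.
Qed.

Lemma ltn_sorted_uniq (s : seq nat) : sorted ltn s -> uniq s.
Proof. exact: (sorted_uniq ltn_trans ltnn). Qed.

Lemma mem_rcons_rem (s : seq nat) a w x : uniq s ->
  (x \in rcons (rem a s) w) = (x == w) || ((x != a) && (x \in s)).
Proof. by move=> us; rewrite mem_rcons inE mem_rem_uniq. Qed.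

Lemma rem_cat_notin (s t : seq nat) c : c \notin s -> rem c (s ++ t) = s ++ rem c t.
Proof.
elim: s => [//|x s IH] /=; rewrite inE negb_or eq_sym => /andP[/negbTE -> /IH ->].
by [].
Qed.

(** * Blue extensions in a coloring that avoids both structures *)

Section Extension.

Variables (N k n : nat) (R : pred (seq nat)).

(** Vertex sets are increasing lists, so [behead] drops the least vertex and [rcons] adds a new
    greatest one. Searching [iota 0 N] keeps the predicate Boolean. *)
Fixpoint alive (i : nat) (t : seq nat) : bool :=
  if i is i'.+1 then
    has (fun w => [&& all (ltn^~ w) t, ~~ R (rcons t w)
                    & alive i' (rcons (behead t) w)]) (iota 0 N)
  else true.

Lemma aliveS i t w : w < N -> all (ltn^~ w) t -> ~~ R (rcons t w) ->
  alive i (rcons (behead t) w) -> alive i.+1 t.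
Proof.
move=> wN tw bl al; apply/hasP; exists w; first by rewrite mem_iota.
by apply/and3P.
Qed.

Lemma alive_pred i t : alive i.+1 t -> alive i t.
Proof.
elim: i t => [//|i IH] t /hasP[w]; rewrite mem_iota => /andP[_ wN] /and3P[tw bl].
by move/IH; apply: aliveS.
Qed.

(** The witnesses of [alive], read in order, form [q]. As [t] has k-1 vertices, [t ++ q] has exactly
    i windows of length k. *)
Lemma alive_path i t : t != [::] -> (size t).+1 = k -> sorted ltn t ->
    all (gtn N) t -> alive i t ->
  exists q, [/\ size q = i, sorted ltn (t ++ q), all (gtn N) (t ++ q) &
             forall j, j < i -> ~~ R (take k (drop j (t ++ q)))].
Proof.
elim: i t => [|i IH] t t0 st tS tN; first by exists [::]; rewrite cats0.
case/hasP=> w; rewrite mem_iota => /andP[_ wN] /and3P[tw bl al].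
case: t => // x t in t0 st tS tN tw bl al *.
have tS' : sorted ltn (rcons (x :: t) w) by rewrite ltn_sorted_rcons tS.
have tN' : all (gtn N) (rcons t w).
  by rewrite all_rcons /= (wN : w < N); case/andP: tN.
have [|||q [sq qS qN qB]] := IH (rcons t w) _ _ _ tN' al.
- by case: (t).
- by rewrite size_rcons.
- exact: path_sorted tS'.
exists (w :: q); rewrite -cat_rcons; split.
- by rewrite /= sq.
- rewrite /= cat_path; apply/andP; split; first exact: tS'.
  by move: qS; case: (t) => [|y t'] //=; rewrite cat_path => /andP[].
- rewrite /= qN andbT; by case/andP: tN.
case=> [|j] jq; last exact: qB.
by rewrite drop0 take_size_cat // size_rcons.
Qed.

Hypotheses (hk : 2 < k) (hkn : k < n).
Hypothesis noconf : forall e w a b, sorted ltn (rcons e w) ->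
  all (gtn N) (rcons e w) -> size e = k -> a \in e -> b \in e -> a != b ->
  R e -> R (rcons (rem a e) w) -> R (rcons (rem b e) w) -> False.
Hypothesis nopath : forall p, sorted ltn p -> all (gtn N) p -> size p = n ->
  exists2 j, j <= n - k & R (take k (drop j p)).

(** * From one block to the block before it *)

Section Step.

Variables (i m : nat).
Hypothesis mN : m + n.*2.-1 <= N.
Hypothesis few : forall s, size s = k - 2 -> sorted ltn s -> all (gtn m) s ->
  count (fun z => ~~ alive i (rcons s z)) (iota m n.*2.-1) < n.

Lemma two_dead e a b : size e = k -> sorted ltn e -> all (gtn m) e ->
  a \in e -> b \in e -> a != b ->
  ~~ alive i.+1 (rem a e) -> ~~ alive i.+1 (rem b e) -> ~~ R e.
Proof.
move=> se eS em ae be ab da db; apply/negP => Re.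
have sub c : c \in e -> [/\ sorted ltn (rem c e), all (gtn m) (rem c e)
                          & size (rem c e) = k.-1].
  move=> ce; split.
  - by apply: subseq_sorted eS => //; [exact: ltn_trans | exact: rem_subseq].
  - by apply/allP => x /mem_rem; apply/allP.
  - by rewrite size_rem // se.
have fewb c : c \in e ->
    count (fun z => ~~ alive i (rcons (behead (rem c e)) z)) (iota m n.*2.-1) < n.
  case/sub=> cS cm sc; apply: few.
  - by rewrite size_behead sc; lia.
  - by case: (rem c e) cS => //= x t /path_sorted.
  - by apply/allP => x /mem_behead; apply/allP.
(* At most n-1 vertices are bad for each of the two sets, and the block has 2(n-1)+1 vertices. *)
have [w wI] : exists2 w, w \in iota m n.*2.-1 &
    alive i (rcons (behead (rem a e)) w) && alive i (rcons (behead (rem b e)) w).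
  apply/hasP; apply/negPn; rewrite -all_predC all_count; apply/negP => /eqP.
  set P := fun z => ~~ alive i (rcons (behead (rem a e)) z).
  set Q := fun z => ~~ alive i (rcons (behead (rem b e)) z).
  rewrite size_iota (_ : count _ _ = count (predU P Q) (iota m n.*2.-1)).
    move: (fewb a ae) (fewb b be) (count_predUI P Q (iota m n.*2.-1)).
    rewrite -/P -/Q; lia.
  by apply: eq_count => z /=; rewrite negb_and.
case/andP=> wa wb; move: wI; rewrite mem_iota => /andP[mw wm].
have wN : w < N by apply: leq_trans wm mN.
have red c : c \in e -> ~~ alive i.+1 (rem c e) ->
    alive i (rcons (behead (rem c e)) w) -> R (rcons (rem c e) w).
  (* If this set were blue, [w] would start an extension of [rem c e] by i+1 vertices. *)
  case/sub=> _ cm _ dc wc; apply/negPn; apply/negP => bl; case/negP: dc.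
  apply: aliveS wN _ bl wc.
  by apply: sub_all cm => x /= xm; apply: leq_trans xm mw.
apply: (@noconf e w a b) => //; [| |exact: red|exact: red].
- rewrite ltn_sorted_rcons eS.
  by apply: sub_all em => x /= xm; apply: leq_trans xm mw.
- rewrite all_rcons /= wN; apply: sub_all em => x /= xm.
  by apply: ltn_trans wN; apply: leq_trans xm mw.
Qed.

Variables (s Z : seq nat).
Hypothesis sizes : size s = k - 2.
Hypothesis sZS : sorted ltn (s ++ Z).
Hypothesis sZm : all (gtn m) (s ++ Z).
Hypothesis dead1 : forall z, z \in Z -> ~~ alive i.+1 (rcons s z).

Lemma drop_cat_subseq j u : subseq u Z -> subseq (drop j s ++ u) (s ++ Z).
Proof.
by move=> uZ; apply: cat_subseq => //; rewrite -{2}(cat_take_drop j s) suffix_subseq.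
Qed.

Lemma sorted_drop_cat j u : subseq u Z -> sorted ltn (drop j s ++ u).
Proof. by move/(drop_cat_subseq j)/subseq_sorted; apply => //; exact: ltn_trans. Qed.

(** Deleting either of two elements of [u] leaves [drop j s] with j+1 elements of [Z], a dead set,
    so [two_dead] applies. *)
Lemma blue_of_dead j : j <= k - 2 ->
  (forall u, subseq u Z -> size u = j.+1 -> ~~ alive i.+1 (drop j s ++ u)) ->
  forall u, subseq u Z -> size u = j.+2 -> ~~ R (drop j s ++ u).
Proof.
move=> jk dead u uZ su.
have eS := sorted_drop_cat j uZ.
have [a [b [au bu ab]]] : exists a b, [/\ a \in u, b \in u & a != b].
  case: u su eS {uZ} => [|a [|b u]] // _ /ltn_sorted_uniq.
  rewrite cat_uniq => /and3P[_ _ /= /andP[]]; rewrite inE negb_or => /andP[ab _] _.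
  by exists a, b; rewrite !inE !eqxx orbT.
have remu c : c \in u -> ~~ alive i.+1 (rem c (drop j s ++ u)).
  move=> cu; have /ltn_sorted_uniq ue := eS.
  have cs : c \notin drop j s.
    move: ue; rewrite cat_uniq => /and3P[_ /hasPn h _].
    by move: (h c cu).
  rewrite rem_cat_notin //; apply: dead; last by rewrite size_rem // su.
  exact: subseq_trans (rem_subseq _ _) uZ.
apply: (@two_dead _ a b) => //.
- by rewrite size_cat size_drop sizes su; lia.
- by apply/allP => x /(mem_subseq (drop_cat_subseq j uZ)); apply/allP.
- by rewrite mem_cat au orbT.
- by rewrite mem_cat bu orbT.
- exact: remu.
- exact: remu.
Qed.

(** Induction on j: each step trades the least remaining element of [s] for one more element of [Z],
    keeping the size k-1. *)
Lemma dead_subseq j u : j <= k - 2 -> subseq u Z -> size u = j.+1 ->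
  ~~ alive i.+1 (drop j s ++ u).
Proof.
elim: j u => [|j IH] u jk uZ su.
  case: u su uZ => [|z []] //= _; rewrite sub1seq => /dead1.
  by rewrite drop0 cats1.
have bl := blue_of_dead (ltnW jk) (fun u => IH u (ltnW jk)) uZ su.
case/lastP: u => // u a in su uZ bl *.
rewrite size_rcons in su; case: su => su.
have uZ' : subseq u Z by apply: subseq_trans uZ; exact: subseq_rcons.
have dt := IH u (ltnW jk) uZ' su.
have eS := sorted_drop_cat j uZ.
have aZ : a < N.
  have : a \in s ++ Z.
    by rewrite mem_cat (mem_subseq uZ) ?orbT // mem_rcons mem_head.
  by move/(allP sZm) => /= am; apply: leq_trans am _; apply: leq_trans mN; exact: leq_addr.
apply/negP => al; case/negP: dt.
rewrite -rcons_cat in eS bl; rewrite -rcons_cat in al.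
move: eS; rewrite ltn_sorted_rcons => /andP[_ eS].
(* Shifting the dead set [drop j s ++ u] along the blue edge ending in [a] gives the set assumed
   (i+1)-alive; i-alive already contradicts deadness. *)
apply: (aliveS aZ eS bl); apply: alive_pred.
have js : j < size s by rewrite sizes; lia.
by rewrite (drop_nth 0 js).
Qed.

Lemma few_dead_step : size Z < n.
Proof.
rewrite ltnNge; apply/negP => nZ.
have tZ : subseq (take n Z) Z by exact: take_subseq.
have sub p : subseq p Z -> sorted ltn p /\ all (gtn N) p.
  move=> pZ; have pZ' : subseq p (s ++ Z).
    by apply: subseq_trans pZ _; exact: suffix_subseq.
  split; first by apply: subseq_sorted pZ' sZS; exact: ltn_trans.
  apply/allP => x /(mem_subseq pZ') /(allP sZm) /= xm.
  by apply: leq_trans xm _; apply: leq_trans mN; exact: leq_addr.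
have [tS tN] := sub _ tZ.
have [j jn] := nopath tS tN (size_takel nZ).
apply/negP; set p := take k _.
have pZ : subseq p Z.
  apply: subseq_trans tZ; apply: subseq_trans (take_subseq _ _) _.
  exact: drop_subseq.
have sp : size p = (k - 2).+2.
  rewrite size_takel; first by lia.
  by rewrite size_drop size_takel //; lia.
(* At j = k-2 nothing of [s] remains, so every k-subset of [Z] is blue, the red window [p]
   included. *)
rewrite -[p]cat0s -(drop_oversize (s := s) (n := k - 2)) ?sizes //.
apply: blue_of_dead => // u; exact: dead_subseq.
Qed.

End Step.

(** Induction on i. The first of the i+1 blocks starting at [m] is the one counted; the induction
    hypothesis is used on the next block. Every set is 0-alive. *)
Lemma few_dead i m s : m + i.+1 * n.*2.-1 <= N ->
  size s = k - 2 -> sorted ltn s -> all (gtn m) s ->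
  count (fun z => ~~ alive i (rcons s z)) (iota m n.*2.-1) < n.
Proof.
elim: i m s => [|i IH] m s mN ss sS sm.
  by rewrite /= (eq_count (a2 := pred0)) // count_pred0; lia.
rewrite -size_filter; set Z := filter _ _.
have mN' : m + n.*2.-1 + i.+1 * n.*2.-1 <= N by rewrite -addnA -mulSn.
apply: (@few_dead_step i (m + n.*2.-1) _ _ s) => //.
- by apply: leq_trans mN'; rewrite mulSn leq_add2l leq_addr.
- by move=> s' *; apply: IH.
- have ZS : sorted ltn Z by apply: sorted_filter (iota_ltn_sorted _ _); exact: ltn_trans.
  rewrite (sorted_pairwise ltn_trans) pairwise_cat -!(sorted_pairwise ltn_trans) sS ZS.
  rewrite !andbT; apply/allrelP => x z /(allP sm) /= xm.
  by rewrite mem_filter mem_iota => /and3P[_ mz _]; apply: leq_trans xm mz.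
- rewrite all_cat; apply/andP; split.
    by apply: sub_all sm => x /= xm; lia.
  by apply/allP => z; rewrite mem_filter mem_iota => /and3P[].
- by move=> z; rewrite mem_filter => /andP[].
Qed.

(** * The bound for an avoiding coloring *)

Lemma avoider_lt : N < 2 * n ^ 2.
Proof.
rewrite ltnNge; apply/negP => hN.
(* A start of k-1 vertices and n-k+1 further ones make n. *)
pose i := (n - k).+1; pose s := iota 0 (k - 2).
have sm : all (gtn (k - 2)) s by apply/allP => x; rewrite mem_iota.
have sS : sorted ltn s by exact: iota_ltn_sorted.
have bound : k - 2 + i.+1 * n.*2.-1 <= N.
  (* The left side is largest at k = 3, where it equals 2n^2 - 3n + 2. *)
  by apply: leq_trans hN; rewrite /i; nia.
have := few_dead bound (size_iota _ _) sS sm.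
set P := fun z => ~~ alive i _ => hc.
have [z zI az] : exists2 z, z \in iota (k - 2) n.*2.-1 & alive i (rcons s z).
  apply/hasP; apply/negPn; rewrite -all_predC all_count; apply/negP => /eqP.
  by rewrite size_iota (eq_count (a2 := P)) //; lia.
move: zI; rewrite mem_iota => /andP[kz zk].
have zN : z < N.
  by apply: leq_trans zk _; apply: leq_trans bound; rewrite mulSn leq_add2l leq_addr.
have [|||| q [sq qS qN qB]] := alive_path _ _ _ _ az.
- by case: (s).
- by rewrite size_rcons size_iota; lia.
- rewrite ltn_sorted_rcons sS; apply: sub_all sm => x /= xk; lia.
- by rewrite all_rcons /= zN; apply: sub_all sm => x /= xk; lia.
have [|j jn] := nopath qS qN.
  by rewrite size_cat size_rcons size_iota sq /i; lia.
by apply/negP; apply: qB.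
Qed.

End Extension.

(** * From sequences back to sets, and the Ramsey number *)

Definition oset (N : nat) (s : seq nat) : {set 'I_N} := [set x : 'I_N | val x \in s].

Lemma card_oset N s : uniq s -> all (gtn N) s -> #|oset N s| = size s.
Proof.
move=> us sN; rewrite cardE -(size_map val); apply/perm_size/uniq_perm => //.
  by rewrite map_inj_uniq ?enum_uniq //; exact: val_inj.
move=> x; apply/mapP/idP => [[y]|xs].
  by rewrite mem_enum inE => ys ->.
by exists (Ordinal (allP sN x xs)); rewrite ?mem_enum ?inE.
Qed.

Lemma red_configuration_oset k N (red : pred {set 'I_N}) e w a b :
  sorted ltn (rcons e w) -> all (gtn N) (rcons e w) -> size e = k ->
  a \in e -> b \in e -> a != b -> red (oset N e) ->
  red (oset N (rcons (rem a e) w)) -> red (oset N (rcons (rem b e) w)) ->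
  red_configuration k red.
Proof.
move=> ewS ewN se ae be ab re ra rb.
have uew := ltn_sorted_uniq ewS.
have [eS ew] : sorted ltn e /\ all (ltn^~ w) e.
  by apply/andP; rewrite -ltn_sorted_rcons.
have ue := ltn_sorted_uniq eS.
have [eN wN] : all (gtn N) e /\ w < N by move: ewN; rewrite all_rcons => /andP[].
have we : w \notin e by move: uew; rewrite rcons_uniq => /andP[].
have k0 : 0 < k by rewrite -se; case: (e) ae.
have rew : oset N e \in red_ksubsets k red (oset N (rcons e w)).
  rewrite inE re card_oset // se eqxx !andbT; apply/subsetP => x.
  by rewrite !inE mem_rcons inE orbC => ->.
have rem_red c : c \in e -> red (oset N (rcons (rem c e) w)) ->
    oset N (rcons (rem c e) w) \in red_ksubsets k red (oset N (rcons e w)).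
  move=> ce rc; rewrite inE rc andbT; apply/andP; split.
    apply/subsetP => x; rewrite !inE mem_rcons_rem // mem_rcons inE.
    by case: eqP => //= _ /andP[].
  rewrite card_oset.
  - by rewrite size_rcons size_rem // se prednK.
  - by rewrite rcons_uniq rem_uniq // andbT; apply: contra we; exact: mem_rem.
  - rewrite all_rcons /= wN; apply/allP => x /mem_rem; exact: (allP eN).
exists (oset N (rcons e w)); split.
- by rewrite card_oset // size_rcons se.
- set A := oset N (rcons (rem a e) w); set B := oset N (rcons (rem b e) w).
  (* The three red sets are distinct: [w] separates [e] from the other two, and [b] separates those
     from each other. *)
  have neq c : oset N e != oset N (rcons (rem c e) w).
    apply/eqP => /setP /(_ (Ordinal wN)); rewrite !inE /= mem_rcons_rem // eqxx.
    by rewrite (negbTE we).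
  have AB : A != B.
    apply/eqP => /setP /(_ (Ordinal (allP eN b be))).
    rewrite !inE /= !mem_rcons_rem // eqxx be (eq_sym b a) ab /= orbT orbF.
    by move/esym/eqP => bw; rewrite -bw be in we.
  have <- : #|[set oset N e; A; B]| = 3.
    by rewrite -setUA cardsU1 cards2 AB !inE negb_or !neq.
  apply: subset_leq_card; apply/subsetP => E; rewrite !inE -orbA.
  by case/or3P => /eqP ->; have := rew; have := rem_red a ae ra;
    have := rem_red b be rb; rewrite !inE.
exists (oset N e) => // x y; rewrite !inE mem_rcons inE => xe /andP[/negbTE ->].
by rewrite orbF => /eqP ->; exact: (allP ew).
Qed.

Lemma blue_tight_path_oset k n N (red : pred {set 'I_N}) p : 0 < k -> k <= n ->
  sorted ltn p -> all (gtn N) p -> size p = n ->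
  (forall j, j <= n - k -> ~~ red (oset N (take k (drop j p)))) ->
  blue_tight_path k n red.
Proof.
move=> k0 kn pS pN sp bl.
have pi (i : 'I_n) : nth 0 p i < N.
  by have /(allP pN) : nth 0 p i \in p by rewrite mem_nth // sp.
exists (fun i => Ordinal (pi i)); split=> [i j ij | e /imsetP[j _ ->]] /=.
  by apply: (sorted_ltn_nth ltn_trans 0 pS); rewrite ?inE ?sp.
(* The j-th edge maps onto the window of [p] at j: index i of the path is position i-j of the
   window. *)
set im := _ @: _; have -> : im = oset N (take k (drop j p)); last first.
  exact: bl (ltn_ord j).
have jn : j + k <= n by have := ltn_ord j; lia.
apply/setP => x; rewrite [in RHS]inE; apply/imsetP/idP => [[i]|xp]; last first.
  pose d := index (val x) (take k (drop j p)).
  have dk : d < k.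
    rewrite -[k in d < k](_ : size (take k (drop j p)) = k) ?index_mem //.
    by rewrite size_takel // size_drop sp; lia.
  have jdn : j + d < n by lia.
  exists (Ordinal jdn); first by rewrite inE /=; lia.
  apply: val_inj; rewrite /= -nth_drop -(nth_take 0 dk).
  by rewrite nth_index.
rewrite inE => /andP[ji ijk] ->; rewrite /=.
have -> : nth 0 p i = nth 0 (take k (drop j p)) (i - j).
  by rewrite nth_take ?nth_drop ?subnKC //; lia.
by rewrite mem_nth // size_takel ?size_drop ?sp; lia.
Qed.

(** A coloring with neither structure, read on lists through [oset], satisfies [noconf] and
    [nopath], so [avoider_lt] contradicts the size of N. *)
Lemma ramsey_property_sqr k n N : 3 <= k -> k < n -> 2 * n ^ 2 <= N ->
  ramsey_property k n N.
Proof.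
move=> hk hkn hN red.
case: (classic (red_configuration k red)) => [|noconf]; [by right | left].
apply: NNPP => nopath.
have [] : ~ N < 2 * n ^ 2 by rewrite ltnNge hN.
apply: (@avoider_lt N k n (fun s => red (oset N s)) hk hkn).
- move=> e w a b ewS ewN se ae be ab re ra rb; apply: noconf.
  exact: red_configuration_oset ewS ewN se ae be ab re ra rb.
move=> p pS pN sp; apply: NNPP => none; apply: nopath.
apply: blue_tight_path_oset pS pN sp _; [lia|lia|].
move=> j jn; apply/negP => rj; apply: none; by exists j.
Qed.

(** This yields the value f_k(n) itself; as [P] is an arbitrary [Prop], the descent decides
    classically whether a smaller witness exists. *)
Lemma ex_least (P : nat -> Prop) m : P m ->
  exists2 l, P l /\ (forall j, P j -> l <= j) & l <= m.
Proof.
elim/ltn_ind: m => m IH Pm.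
case: (classic (exists2 j, P j & j < m)) => [[j Pj jm]|none].
  by have [l Pl lj] := IH j jm Pj; exists l => //; apply: leq_trans lj (ltnW jm).
exists m => //; split=> // j Pj; rewrite leqNgt; apply/negP => jm.
by apply: none; exists j.
Qed.

Theorem theorem7 (k n : nat) (hk : 3 <= k) (hkn : k < n) :
  exists2 N : nat, is_f k n N & N <= 2 * n ^ 2.
Proof.
exact: ex_least (ramsey_property_sqr hk hkn (leqnn _)).
Qed.
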